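(* Let $X$ be a completely regular Hausdorff topological space. Then the following assertions are equivalent: (i) $X$ is functorially Lindelöfifiable (i.e. $X$ admits a functorial Lindelöfification). (ii) The realcompactification $\upsilon X$ of $X$ is Lindelöf. (iii) There exists a Lindelöf (completely regular Hausdorff) space $Y$ such that $C(X)$ is isomorphic as a ring to $C(Y)$.
   Context: All topological spaces are assumed to be completely regular and Hausdorff. $C(X)$ is the ring of continuous functions $X\to\mathbb{R}$, and $\beta X$ is the Stone–Čech compactification of $X$. The space $X$ admits a functorial Lindelöfification if there exist a Lindelöf (completely regular Hausdorff) space $\nu X$ and a continuous map $i_X: X\to\nu X$ such that for every Lindelöf (completely regular Hausdorff) space $Y$ and every continuous map $f: X\to Y$ there is a unique continuous map $\tilde f:\nu X\to Y$ with $f=\tilde f\circ i_X$. The realcompactification $\upsilon X\subset\beta X$ is the subspace of all points $x\in\beta X$ such that every continuous map $X\to\mathbb{R}$ extends to a continuous map $X\cup\{x\}\to\mathbb{R}$. *)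

(* Defs.v *)
From HB Require Import structures.
From mathcomp Require Import all_boot all_order all_algebra.
From mathcomp Require Import all_classical all_reals all_analysis.

Set Implicit Arguments.
Unset Strict Implicit.
Unset Printing Implicit Defensive.

Import Order.TTheory GRing.Theory Num.Theory.
Import numFieldNormedType.Exports.

Local Open Scope classical_set_scope.
Local Open Scope ring_scope.

Definition tychonoff_space (T : topologicalType) : Prop :=
  hausdorff_space T /\ completely_regular_space T.

Definition lindelof_space (T : topologicalType) : Prop :=
  forall F : set (set T), (forall U, F U -> open U) -> \bigcup_(U in F) U = setT ->
  exists G : set (set T),
    [/\ G `<=` F, countable G & \bigcup_(U in G) U = setT].

Definition functorially_lindelofifiable (X : topologicalType) : Prop :=
  exists (nuX : topologicalType) (i : X -> nuX),
    [/\ tychonoff_space nuX, lindelof_space nuX, continuous i &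
      forall (Y : topologicalType) (f : X -> Y),
        tychonoff_space Y -> lindelof_space Y -> continuous f ->
        exists! g : nuX -> Y, continuous g /\ f = g \o i].

Section ContinuousRing.
Context {R : realType} {X : topologicalType}.
Implicit Types f g h : continuousType X R.

Definition cts_zero : continuousType X R := cst 0.
Definition cts_one : continuousType X R := cst 1.
Definition cts_opp f : continuousType X R :=
  mkcts (fun x => continuousN (@cts_fun X R f x)).
Definition cts_add f g : continuousType X R :=
  mkcts (fun x => continuousD (@cts_fun X R f x) (@cts_fun X R g x)).
Definition cts_mul f g : continuousType X R :=
  mkcts (fun x => continuousM (@cts_fun X R f x) (@cts_fun X R g x)).

Fact cts_addA : associative cts_add.
Proof. by move=> f g h; apply/continuousEP => x; exact: addrA. Qed.
Fact cts_addC : commutative cts_add.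
Proof. by move=> f g; apply/continuousEP => x; exact: addrC. Qed.
Fact cts_add0 : left_id cts_zero cts_add.
Proof. by move=> f; apply/continuousEP => x; exact: add0r. Qed.
Fact cts_addN : left_inverse cts_zero cts_opp cts_add.
Proof. by move=> f; apply/continuousEP => x; exact: addNr. Qed.

HB.instance Definition _ := GRing.isZmodule.Build (continuousType X R)
  cts_addA cts_addC cts_add0 cts_addN.

Fact cts_mulA : associative cts_mul.
Proof. by move=> f g h; apply/continuousEP => x; exact: mulrA. Qed.
Fact cts_mulC : commutative cts_mul.
Proof. by move=> f g; apply/continuousEP => x; exact: mulrC. Qed.
Fact cts_mul1 : left_id cts_one cts_mul.
Proof. by move=> f; apply/continuousEP => x; exact: mul1r. Qed.
Fact cts_mulDl : left_distributive cts_mul cts_add.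
Proof. by move=> f g h; apply/continuousEP => x; exact: mulrDl. Qed.

(* Only a [comPzRingType]: C(X) is the zero ring when X is empty. *)
HB.instance Definition _ := GRing.Zmodule_isComPzRing.Build (continuousType X R)
  cts_mulA cts_mulC cts_mul1 cts_mulDl.
End ContinuousRing.

(* The Stone-Cech compactification, built as the closure of the image of X under
   the evaluation map X -> [0,1]^C(X,[0,1]). *)
Section StoneCech.
Context (R : realType) (X : topologicalType).

Definition unit_itv : topologicalType := set_type (`[0%R, 1%R] : set R).

Definition tychonoff_cube : topologicalType :=
  prod_topology (fun _ : continuousType X unit_itv => unit_itv).

Definition cube_eval : X -> tychonoff_cube :=
  join_product (fun h : continuousType X unit_itv => h).

Definition stone_cech : topologicalType :=
  set_type (closure (range cube_eval)).

Definition stone_cech_in (x : X) : stone_cech :=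
  SigSub (mem_set (subset_closure (imageT cube_eval x))).

Definition realcompactification : set stone_cech :=
  [set b | forall f : X -> R, continuous f ->
    exists g : stone_cech -> R,
      {within range stone_cech_in `|` [set b], continuous g} /\
      forall x, g (stone_cech_in x) = f x].

End StoneCech.
Arguments unit_itv : clear implicits.
Arguments tychonoff_cube : clear implicits.
Arguments stone_cech : clear implicits.
Arguments realcompactification : clear implicits.
Arguments cube_eval R {X}.
Arguments stone_cech_in R {X}.

(* [stone_cech] is compact Hausdorff, contains X as a dense subspace, and has the
   universal property of the Stone-Cech compactification. *)
Section StoneCechTheory.
Context {R : realType}.
Local Notation I := (unit_itv R).

Lemma compact_set_type {T : topologicalType} (A : set T) :
  compact A -> compact [set: set_type A].
Proof.
move=> cA F PF _.
have PG : ProperFilter (fmap (set_val : A -> T) F) by exact: fmap_proper_filter.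
have GA : fmap (set_val : A -> T) F A.
  by rewrite /fmap /=; apply: filterS (@filterT _ F _) => y _; exact: set_valP.
have [x [Ax clx]] := cA _ PG GA.
exists (SigSub (mem_set Ax)); split => // B C FB /= [D /= [[W oW WD] Dx DC]].
have Gv : fmap (set_val : A -> T) F (set_val @` B).
  by rewrite /fmap /=; apply: filterS FB => y By /=; exists y.
have nW : nbhs x W.
  by apply: open_nbhs_nbhs; split => //; move: Dx; rewrite -WD.
have [z [[y By yz] Wz]] := clx _ _ Gv nW.
exists y; split => //; apply: DC; rewrite -WD.
by rewrite /= -yz in Wz.
Qed.

Lemma hausdorff_set_type {T : topologicalType} (A : set T) :
  hausdorff_space T -> hausdorff_space (set_type A).
Proof.
move=> hT p q clpq; apply: val_inj; apply: hT => B C Bp Cq.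
have sv : continuous (set_val : A -> T) by exact: initial_continuous.
by have [z [Bz Cz]] := clpq _ _ (sv p _ Bp) (sv q _ Cq); exists (set_val z).
Qed.

Lemma unit_itv_compact : compact [set: I].
Proof. by apply: compact_set_type; exact: segment_compact. Qed.

Lemma unit_itv_hausdorff : hausdorff_space I.
Proof. by apply: hausdorff_set_type; exact: Rhausdorff. Qed.

Lemma tychonoff_cube_compact (X : topologicalType) :
  compact [set: tychonoff_cube R X].
Proof.
have := @tychonoff (continuousType X I) (fun=> I) (fun=> setT)
  (fun=> unit_itv_compact).
by congr compact; apply/seteqP; split.
Qed.

Lemma tychonoff_cube_hausdorff (X : topologicalType) :
  hausdorff_space (tychonoff_cube R X).
Proof.
apply: (@hausdorff_product (continuousType X I) (fun=> I)) => _.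
exact: unit_itv_hausdorff.
Qed.

Lemma stone_cech_compact (X : topologicalType) : compact [set: stone_cech R X].
Proof.
apply: compact_set_type; apply: (subclosed_compact _ (@tychonoff_cube_compact X)).
  exact: closed_closure.
by [].
Qed.

Lemma stone_cech_hausdorff (X : topologicalType) :
  hausdorff_space (stone_cech R X).
Proof. exact/hausdorff_set_type/tychonoff_cube_hausdorff. Qed.

Lemma cube_separates (X : topologicalType) : completely_regular_space X ->
  separate_points_from_closed (fun h : continuousType X I => (h : X -> I)).
Proof.
move=> crX U x cU nUx.
have [f [cf f01 f0 f1]] := (@uniform_separatorP X R _ _).1 (crX x U cU nUx).
have m y : f y \in (`[0%R, 1%R]%classic : set R) by apply/mem_set/f01; exists y.
pose h : X -> I := fun y => SigSub (m y).
have ch : continuous h by exact: continuous_comp_initial.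
exists (mkcts ch : continuousType X I) => clo.
have c1 : closed ((set_val : I -> R) @^-1` [set 1]).
  apply: preimage_closed; last exact: closed_eq.
  by move=> y _; exact: initial_continuous.
have hU1 : h @` U `<=` (set_val : I -> R) @^-1` [set 1].
  by move=> _ [y Uy <-]; apply: f1; exists y.
have /= fx1 : f x = 1 by apply: (c1 (h x)); exact: closureS hU1 _ clo.
have fx0 : f x = 0 by apply: f0; exists x.
by have /eqP := oner_neq0 R; rewrite -fx1 fx0.
Qed.

Lemma cube_eval_continuous (X : topologicalType) :
  continuous (@cube_eval R X).
Proof.
move=> x; apply/cvg_sup => h U /= [V /= [[W oW <-] Wx WU]].
suff : nbhs x ((h : X -> I) @^-1` W) by apply: filterS => y Wy; exact: WU.
by apply: (@cts_fun X I h x); exact: open_nbhs_nbhs.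
Qed.

Lemma stone_cech_in_continuous (X : topologicalType) :
  continuous (@stone_cech_in R X).
Proof. by apply: continuous_comp_initial; exact: cube_eval_continuous. Qed.

Lemma stone_cech_in_dense (X : topologicalType) :
  closure (range (@stone_cech_in R X)) = setT.
Proof.
apply/seteqP; split => // -[p mp] _ B /= [C /= [[W oW WC] Cp CB]].
have Wp : W p by move: Cp; rewrite -WC.
have [q [[x _ <-] Wq]] := set_mem mp W (open_nbhs_nbhs (conj oW Wp)).
by exists (stone_cech_in R x); split; [exists x | apply: CB; rewrite -WC].
Qed.

Lemma stone_cech_in_inj (X : topologicalType) :
  tychonoff_space X -> injective (@stone_cech_in R X).
Proof.
move=> [hX crX] x y /(congr1 val) /= exy.
apply: (join_product_inj (cube_separates crX) (hausdorff_accessible hX));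
  by rewrite ?inE.
Qed.

Lemma stone_cech_in_initial (X : topologicalType) :
  tychonoff_space X ->
  forall U : set X, open U ->
    exists2 V, open V & @stone_cech_in R X @^-1` V = U.
Proof.
move=> [hX crX] U.
have sep := cube_separates crX.
have cts (h : continuousType X I) : continuous h by exact: cts_fun.
have inj := join_product_inj sep (hausdorff_accessible hX).
rewrite (join_product_initial sep cts inj) => -[W oW WU].
exists (val @^-1` W) => //.
by exists W.
Qed.

Lemma stone_cech_extend (X K : topologicalType) (f : X -> K) :
  hausdorff_space K -> compact [set: K] -> continuous f ->
  exists! g : stone_cech R X -> K, continuous g /\ f = g \o @stone_cech_in R X.
Proof.
move=> hK cK cf.
have crK : completely_regular_space K.
  apply: (@normal_completely_regular R).
    exact: compact_normal.
  exact: hausdorff_accessible.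
pose F (p : tychonoff_cube R X) : tychonoff_cube R K :=
  fun h => p (h \o mkcts cf).
have cF : continuous F.
  move=> p; apply/cvg_sup; first exact/fmap_filter/(@nbhs_filter _ p).
  move=> h U /= [V /= [[W oW <-] Wx WU]].
  pose k : continuousType X I := h \o mkcts cf.
  suff : nbhs p (@proj _ (fun=> I) k @^-1` W).
    by apply: filterS => q Wq; exact: WU.
  apply: (@proj_continuous (continuousType X I) (fun=> I) k p).
  exact: open_nbhs_nbhs.
have injK := join_product_inj (cube_separates crK) (hausdorff_accessible hK).
have closedK (C : set K) : closed C -> closed (@cube_eval R K @` C).
  move=> cC; apply: compact_closed; first exact: tychonoff_cube_hausdorff.
  apply: continuous_compact.
    exact/continuous_subspaceT/cube_eval_continuous.
  exact: (subclosed_compact cC cK).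
have img (b : stone_cech R X) : exists k, cube_eval R k = F (val b).
  have : closed (F @^-1` (range (@cube_eval R K))).
    by apply: preimage_closed; [move=> *; exact: cF | exact: closedK closedT].
  rewrite closure_id => clE.
  have : closure (range (@cube_eval R X)) (val b) by apply: set_mem; exact: valP.
  have : range (@cube_eval R X) `<=` F @^-1` (range (@cube_eval R K)).
    by move=> _ [x _ <-]; exists (f x).
  by move=> /closureS /[apply]; rewrite -clE => -[k _ ?]; exists k.
pose g b := projT1 (cid (img b)).
have gE b : cube_eval R (g b) = F (val b) by exact: projT2 (cid (img b)).
have cg : continuous g.
  apply/continuous_closedP => C cC.
  have -> : g @^-1` C = (F \o val) @^-1` (@cube_eval R K @` C).
    apply/seteqP; split=> b /=; first by move=> Cg; exists (g b).
    move=> [k Ck]; rewrite -gE => e.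
    by rewrite -(injK k (g b)) ?inE.
  apply: preimage_closed; last exact: closedK.
  move=> b _; apply: continuous_comp; last exact: cF.
  exact: initial_continuous.
have gf : f = g \o @stone_cech_in R X.
  apply/funext => x; apply: injK; rewrite ?inE//.
  by rewrite -[RHS]/(cube_eval R (g (stone_cech_in R x))) gE.
exists g; split=> // g' [cg' gf'].
apply/funext => b; apply: hK => A B nA nB.
have : nbhs b (g @^-1` A `&` g' @^-1` B).
  by apply: filterI; [exact: cg | exact: cg'].
have : closure (range (@stone_cech_in R X)) b by rewrite stone_cech_in_dense.
move=> /[apply] -[_ [[x _ <-] [gA gB]]].
exists (f x); split; first by rewrite gf.
by rewrite gf'.
Qed.

End StoneCechTheory.

(* Main.v *)
Require Import Defs.
From HB Require Import structures.
From mathcomp Require Import all_boot all_order all_algebra.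
From mathcomp Require Import all_classical all_reals all_analysis.
From mathcomp Require Import finmap lra.
Import numFieldNormedType.Exports.

Set Implicit Arguments.
Unset Strict Implicit.
Unset Printing Implicit Defensive.

Import Order.TTheory GRing.Theory Num.Theory.

Local Open Scope classical_set_scope.
Local Open Scope ring_scope.

(** The theorem rests on one fact ([lindelof_character]): when [Y] is Lindelof,
    every ring homomorphism from [C(Y)] to the reals is the evaluation at a
    point of [Y].  Consequently, for a Lindelof completely regular Hausdorff
    space [Y], every ring homomorphism [C(Y) -> C(X)] is composition with a
    continuous map [X -> Y] ([lindelof_dual]).

    An isomorphism of [C(X)] with [C(Y)] for such a [Y] thus yields a map
    [X -> Y], through which every map from [X] to a Lindelof space factors
    uniquely, again by duality ([isomorphic_lindelofifiable]): (iii) implies (i).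

    A continuous function on [X] has a limit at each point of the
    realcompactification [uX], by definition of [uX].  These limits form a
    continuous function, and taking them is a ring isomorphism from [C(X)] to
    [C(uX)] ([rc_extend_bij]): if [uX] is Lindelof, it can serve as [Y], and (ii)
    implies (iii).

    Finally let [N] be a functorial Lindelofification of [X].  Compact spaces are
    Lindelof, so [X -> bX] extends to [j : N -> bX], where [bX] is the Stone-Cech
    compactification.  The map [j] is an embedding because [0,1]-valued functions
    on [N] are determined by their restrictions to [X], which extend to [bX].
    Its image is [uX]: functions on [X] extend to [N], so the image lies in [uX],
    and a point of [uX] defines a character of [N], which is an evaluation.
    Hence [uX] is a continuous image of [N], so it is Lindelof
    ([lindelofifiable_realcompactification]): (i) implies (ii). *)

(** * Completely regular and Lindelof spaces *)

Section CompletelyRegular.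
Context {R : realType}.

Lemma tychonoff_separates_closed (T : topologicalType) (x : T) (U : set T) :
  tychonoff_space T -> nbhs x U ->
  exists h : continuousType T R,
    [/\ h x = 0, forall z, 0 <= h z <= 1 & forall z, ~ U z -> h z = 1].
Proof.
move=> [_ crT]; rewrite nbhsE => -[V [oV Vx] VU].
have [f [cf f01 f0 f1]] :=
  (@uniform_separatorP T R _ _).1 (crT x (~` V) (open_closedC oV) (fun k => k Vx)).
exists (mkcts cf); split => [|z|z nUz].
- by apply: f0; exists x.
- have : range f (f z) by exists z.
  by move=> /f01; rewrite /= in_itv.
- by apply: f1; exists z => //; apply: contra_not nUz => /VU.
Qed.

Lemma tychonoff_separates_points (T : topologicalType) (x y : T) :
  tychonoff_space T -> (forall h : continuousType T R, h x = h y) -> x = y.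
Proof.
move=> tT hxy; apply: tT.1 => A B nA nB.
have [h [hx _ hA]] := tychonoff_separates_closed tT nA.
exists y; split; last exact: nbhs_singleton.
apply: contrapT => /hA hy1; have := hxy h.
by rewrite hx hy1 => /eqP; rewrite eq_sym oner_eq0.
Qed.

(** The topology of a completely regular space is the one induced by its
    real-valued functions, so continuity into it can be tested on them: this
    makes the maps of spaces obtained from ring maps continuous. *)
Lemma continuous_tychonoff (S T : topologicalType) (t : S -> T) :
  tychonoff_space T -> (forall h : continuousType T R, continuous (h \o t)) ->
  continuous t.
Proof.
move=> tT ct x U nU; have [h [hx _ hU]] := tychonoff_separates_closed tT nU.
have nV : nbhs ((h \o t) x) [set r : R | r < 1].
  by apply: open_nbhs_nbhs; split; [exact: open_lt | rewrite /= hx ltr01].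
have nhV : nbhs x ((h \o t) @^-1` [set r : R | r < 1]) by exact: ct.
have : nbhs x (t @^-1` U); last by [].
apply: filterS nhV => z /= hz.
by apply: contrapT => /hU hz1; rewrite hz1 ltxx in hz.
Qed.

Lemma tychonoff_real : tychonoff_space R.
Proof. by split; [exact: Rhausdorff | exact: (@uniform_completely_regular R R)]. Qed.

Lemma tychonoff_compact (T : topologicalType) :
  hausdorff_space T -> compact [set: T] -> tychonoff_space T.
Proof.
move=> hT cT; split => //; apply: (@normal_completely_regular R).
  exact: compact_normal.
exact: hausdorff_accessible.
Qed.

Lemma tychonoff_set_type (T : topologicalType) (A : set T) :
  tychonoff_space T -> tychonoff_space (set_type A).
Proof.
move=> tT; split; first exact/hausdorff_set_type/tT.1.
move=> a B cB nBa; apply/(@uniform_separatorP _ R).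
have := open_nbhs_nbhs (conj (closed_openC cB) nBa).
move=> [_ [[W oW <-] Wa WB]].
have [h [ha h01 hW]] := tychonoff_separates_closed tT (open_nbhs_nbhs (conj oW Wa)).
exists (h \o val); split.
- move=> x; apply: continuous_comp; last exact: cts_fun.
  exact: initial_continuous.
- by move=> _ [x _ <-]; rewrite /= in_itv; exact: h01.
- by move=> _ [x -> <-].
- by move=> _ [x Bx <-]; apply: hW => Wx; exact: (WB x Wx).
Qed.

End CompletelyRegular.

Lemma lindelof_sequence (T : topologicalType) (I : Type) (U : I -> set T) :
  lindelof_space T -> inhabited I -> (forall i, open (U i)) ->
  (forall x, exists i, U i x) ->
  exists e : nat -> I, forall x, exists n, U (e n) x.
Proof.
move=> lT [i0] oU cU.
have [||G [GU /countable_injP[c cinj] cG]] := lT (range U).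
- by move=> _ [i _ <-]; exact: oU.
- apply/seteqP; split => // x _; have [i Ui] := cU x.
  by exists (U i) => //; exists i.
pose P n i := G (U i) /\ c (U i) = n.
(* [i0] is the value at the integers that code no member of the subcover. *)
exists (fun n => if pselect (exists i, P n i) is left ex then projT1 (cid ex)
                 else i0) => x.
have : (\bigcup_(A in G) A) x by rewrite cG.
move=> [A GA Ax]; exists (c A); case: pselect => [ex|[]]; last first.
  by have [i _ UA] := GU _ GA; exists i; rewrite /P UA.
have [GUi ci] := projT2 (cid ex).
by rewrite (cinj _ _ _ _ ci) //; exact: mem_set.
Qed.

Lemma sigma_compact_lindelof (T : topologicalType) (K : nat -> set T) :
  (forall n, compact (K n)) -> \bigcup_n K n = setT -> lindelof_space T.
Proof.
move=> cK KT F oF cF.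
have [[x0 _]|T0] := pselect (exists x : T, True); last first.
  exists set0; split => //; apply/seteqP; split => // x _.
  by case: T0; exists x.
(* [compact_cover] speaks of pointed spaces, so [x0] is made the point of [T]. *)
pose T' : ptopologicalType := HB.pack_for ptopologicalType T (isPointed.Build T x0).
have fin n : finite_subset_cover F (id : set T -> set T) (K n).
  have cKn : @compact T' (K n) by exact: cK.
  rewrite compact_cover in cKn; apply: cKn => // x _.
  by have : [set: T] x by []; rewrite -cF.
have /choice[D DP] n : exists D : {fset set T},
    {subset D <= F} /\ K n `<=` \bigcup_(A in [set` D]) A.
  by have [D DF DK] := fin n; exists D.
exists (\bigcup_n [set` D n]); split.
- by move=> A [n _ /(DP n).1/set_mem].
- by apply: bigcup_countable => // n _; exact: countable_fset.
- apply/seteqP; split => // x _; have : (\bigcup_n K n) x by rewrite KT.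
  by move=> [n _ /(DP n).2[A DA Ax]]; exists A => //; exists n.
Qed.

Lemma compact_lindelof (T : topologicalType) :
  compact [set: T] -> lindelof_space T.
Proof.
move=> cT; apply: (@sigma_compact_lindelof _ (fun=> setT)) => //.
by apply/seteqP; split => // x _; exists 0%N.
Qed.

Lemma lindelof_real (R : realType) : lindelof_space R.
Proof.
apply: (@sigma_compact_lindelof R (fun n => `[- n%:R, n%:R]%classic)).
  by move=> n; exact: segment_compact.
apply/seteqP; split => // x _; exists (Num.bound `|x|) => //=.
rewrite in_itv /= -ler_norml ltW //.
exact: archi_boundP.
Qed.

Lemma lindelof_image (S T : topologicalType) (t : S -> T) :
  continuous t -> range t = setT -> lindelof_space S -> lindelof_space T.
Proof.
move=> ct rt lS F oF cF.
have [[x0 _]|S0] := pselect (exists x : S, True); last first.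
  exists set0; split => //; apply/seteqP; split => // y _.
  have : range t y by rewrite rt.
  by move=> [x _ _]; case: S0; exists x.
have FT y : exists2 A, F A & A y.
  have : (\bigcup_(A in F) A) y by rewrite cF.
  by move=> [A FA Ay]; exists A.
have [||x|e ecov] := @lindelof_sequence S {A | F A} (fun A => t @^-1` sval A) lS.
- by have [A FA _] := FT (t x0); exists; exists A.
- by move=> [A FA]; apply: open_comp => [x _|]; [exact: ct | exact: oF].
- by have [A FA Ax] := FT (t x); exists (exist _ A FA).
exists (range (sval \o e)); split.
- by move=> _ [n _ <-]; exact: (svalP (e n)).
- by apply: sub_countable (card_image_le _ _) _.
- apply/seteqP; split => // y _; have : range t y by rewrite rt.
  move=> [x _ <-]; have [n en] := ecov x.
  by exists (sval (e n)) => //; exists n.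
Qed.

(** * Ring homomorphisms out of rings of continuous functions *)

Section RingMaps.
Context {R : realType}.

Definition cts_const {X : topologicalType} (r : R) : continuousType X R := cst r.

Definition cts_eval {X : topologicalType} (x : X) (f : continuousType X R) : R :=
  f x.

Definition cts_pull {X Y : topologicalType} (t : continuousType X Y)
  (g : continuousType Y R) : continuousType X R := g \o t.

Fact cts_const_zmod (X : topologicalType) : zmod_morphism (@cts_const X).
Proof. by move=> r s; apply/continuousEP => x. Qed.
Fact cts_const_monoid (X : topologicalType) : monoid_morphism (@cts_const X).
Proof. by split => [|r s]; apply/continuousEP => x. Qed.
HB.instance Definition _ (X : topologicalType) := GRing.isZmodMorphism.Build R (continuousType X R)
  (@cts_const X) (@cts_const_zmod X).
HB.instance Definition _ (X : topologicalType) := GRing.isMonoidMorphism.Build R (continuousType X R)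
  (@cts_const X) (@cts_const_monoid X).

Fact cts_eval_zmod (X : topologicalType) (x : X) : zmod_morphism (cts_eval x).
Proof. by []. Qed.
Fact cts_eval_monoid (X : topologicalType) (x : X) : monoid_morphism (cts_eval x).
Proof. by []. Qed.
HB.instance Definition _ (X : topologicalType) (x : X) := GRing.isZmodMorphism.Build
  (continuousType X R) R (cts_eval x) (cts_eval_zmod x).
HB.instance Definition _ (X : topologicalType) (x : X) := GRing.isMonoidMorphism.Build
  (continuousType X R) R (cts_eval x) (cts_eval_monoid x).

Fact cts_pull_zmod (X Y : topologicalType) (t : continuousType X Y) : zmod_morphism (cts_pull t).
Proof. by move=> f g; apply/continuousEP => x. Qed.
Fact cts_pull_monoid (X Y : topologicalType) (t : continuousType X Y) : monoid_morphism (cts_pull t).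
Proof. by split => [|f g]; apply/continuousEP => x. Qed.
HB.instance Definition _ (X Y : topologicalType) (t : continuousType X Y) := GRing.isZmodMorphism.Build
  (continuousType Y R) (continuousType X R) (cts_pull t) (cts_pull_zmod t).
HB.instance Definition _ (X Y : topologicalType) (t : continuousType X Y) := GRing.isMonoidMorphism.Build
  (continuousType Y R) (continuousType X R) (cts_pull t) (cts_pull_monoid t).

(** Nonnegative reals are the squares, so a ring endomorphism of the reals is
    monotone; it fixes the rationals, which are dense. *)
Lemma real_rmorphism_id (rho : {rmorphism R -> R}) r : rho r = r.
Proof.
have pos s : 0 <= s -> 0 <= rho s.
  by move=> s0; rewrite -(sqr_sqrtr s0) rmorphXn sqr_ge0.
have mono a b : a <= b -> rho a <= rho b.
  by move=> ab; rewrite -subr_ge0 -rmorphB pos // subr_ge0.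
case: (ltgtP (rho r) r) => // /rat_in_itvoo[q]; rewrite in_itv /= => /andP[lq qr].
- by have := mono _ _ (ltW qr); rewrite fmorph_rat leNgt lq.
- by have := mono _ _ (ltW lq); rewrite fmorph_rat leNgt qr.
Qed.

Lemma uniform_approx_continuous (X : topologicalType) (h : X -> R) :
  (forall e : R, 0 < e ->
    exists g : continuousType X R, forall x, `|h x - g x| <= e) ->
  continuous h.
Proof.
move=> app x; apply/cvgrPdist_lt => e e0.
have e3 : 0 < e / 3 by rewrite divr_gt0.
have [g hg] := app _ e3.
have /cvgrPdist_lt/(_ _ e3) := @cts_fun _ _ g x.
apply: filterS => y gxy; have := hg x; have := hg y.
rewrite -[h x - h y](_ : (h x - g x) + (g x - g y) - (h y - g y) = _); last by lra.
move=> hy hx; apply: le_lt_trans (ler_normB _ _) _.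
have := ler_normD (h x - g x) (g x - g y); lra.
Qed.

Section Character.
Context {X : topologicalType} (chi : {rmorphism continuousType X R -> R}).

Lemma character_const r : chi (cts_const r) = r.
Proof. exact: (real_rmorphism_id (chi \o cts_const)). Qed.

(** A pointwise nonnegative function is the square of a continuous one, so ring
    homomorphisms to the reals preserve the order. *)
Lemma character_mono (f g : continuousType X R) :
  (forall x, f x <= g x) -> chi f <= chi g.
Proof.
move=> fg; have cs : continuous (fun x => Num.sqrt ((g - f) x)).
  move=> x; apply: (@continuous_comp _ _ _ (g - f) Num.sqrt).
    exact: cts_fun.
  exact: sqrt_continuous.
pose s : continuousType X R := mkcts cs.
rewrite -subr_ge0 -rmorphB (_ : g - f = s * s).
  by rewrite rmorphM -expr2 sqr_ge0.
apply/continuousEP => x; rewrite -[RHS]/(Num.sqrt (g x - f x) * Num.sqrt (g x - f x)).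
by rewrite -expr2 sqr_sqrtr // subr_ge0.
Qed.

Lemma character_unit (f : continuousType X R) : (forall x, f x != 0) -> chi f != 0.
Proof.
move=> f0; have ci : continuous (fun x => (f x)^-1).
  move=> x; apply: (@continuous_comp _ _ _ f GRing.inv); first exact: cts_fun.
  exact: inv_continuous.
pose i : continuousType X R := mkcts ci.
have : chi f * chi i = 1.
  rewrite -rmorphM -(rmorph1 chi); congr (chi _); apply/continuousEP => x.
  exact: mulfV.
by move=> fV; apply/eqP => cf0; move/eqP: fV; rewrite cf0 mul0r eq_sym oner_eq0.
Qed.

End Character.
End RingMaps.

(** * Characters of a Lindelof space are evaluations *)

Section LindelofCharacter.
Context {R : realType}.

(** The function [h] is the sum of the series of general term
    [2^-(k+1) * f_k^2 / (1 + f_k^2)].  Each term is a multiple of [f_k], so an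
    ideal containing every [f_k] contains the partial sums; these approximate
    [h] within [2^-N], and [h] vanishes nowhere because some [f_k] is nonzero
    at each point. *)
Lemma positive_series (X : topologicalType) (f : nat -> continuousType X R) :
  (forall x, exists n, f n x != 0) ->
  exists (h : continuousType X R) (a : nat -> continuousType X R),
    (forall x, 0 < h x) /\
    forall N x, h x <= (\sum_(k < N) a k * f k : continuousType X R) x + 2^-1 ^+ N.
Proof.
move=> f0.
have cw k : continuous (fun x => 2^-1 ^+ k.+1 * (f k x / (1 + f k x * f k x))).
  move=> x; have cf : f k z @[z --> x] --> f k x by exact: cts_fun.
  apply: cvgM; first exact: cvg_cst.
  apply: cvgM => //; apply: cvgV.
    by rewrite gt_eqF // ltr_pwDl // -expr2 sqr_ge0.
  by apply: cvgD; [exact: cvg_cst | exact: cvgM].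
pose a k : continuousType X R := mkcts (cw k).
pose S N : continuousType X R := \sum_(k < N) a k * f k.
have halfS k : 2^-1 ^+ k = 2^-1 ^+ k.+1 + 2^-1 ^+ k.+1 :> R.
  by rewrite exprS; lra.
have S0 x : S 0%N x = 0 by rewrite /S big_ord0.
have SS N x : S N.+1 x = S N x + (a N * f N : continuousType X R) x.
  by rewrite /S big_ord_recr.
have vE k x : (a k * f k : continuousType X R) x =
    2^-1 ^+ k.+1 * (f k x ^+ 2 / (1 + f k x ^+ 2)).
  rewrite -[LHS]/(2^-1 ^+ k.+1 * (f k x / (1 + f k x * f k x)) * f k x).
  by rewrite !expr2 -mulrA [_ / _ * _]mulrAC.
have p0 k : 0 < 2^-1 ^+ k :> R by rewrite exprn_gt0.
have d0 k x : 0 < 1 + f k x ^+ 2 by rewrite ltr_pwDl // sqr_ge0.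
have v0 k x : 0 <= (a k * f k : continuousType X R) x.
  by rewrite vE mulr_ge0 ?divr_ge0 ?sqr_ge0 // ltW.
have v1 k x : (a k * f k : continuousType X R) x <= 2^-1 ^+ k.+1.
  by rewrite vE ler_piMr ?(ltW (p0 _)) // ler_pdivrMr // mul1r lerDr.
have vp k x : f k x != 0 -> 0 < (a k * f k : continuousType X R) x.
  by move=> fk; rewrite vE mulr_gt0 // divr_gt0 // exprn_even_gt0.
have Sup N k x : S N x <= S (N + k)%N x.
  elim: k => [|k IH]; first by rewrite addn0.
  by rewrite addnS SS; have := v0 (N + k)%N x; lra.
have Sdn N k x : S (N + k)%N x + 2^-1 ^+ (N + k) <= S N x + 2^-1 ^+ N.
  elim: k => [|k IH]; first by rewrite addn0.
  rewrite addnS SS; have := v1 (N + k)%N x; have := halfS (N + k)%N; lra.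
have Sle M N x : S M x <= S N x + 2^-1 ^+ N.
  have [/subnKC <-|/ltnW/subnKC <-] := leqP N M.
    by have := Sdn N (M - N)%N x; have := p0 (N + (M - N))%N; lra.
  by have := Sup M (N - M)%N x; have := p0 (M + (N - M))%N; lra.
(* The partial sums increase, while the partial sums plus [2^-N] decrease; the
   sum of the series is therefore their supremum, and the error is at most
   [2^-N] uniformly in the point. *)
pose E x : set R := range (fun N => S N x).
have E0 x : E x !=set0 by exists (S 0%N x); exists 0%N.
have Eub x N : ubound (E x) (S N x + 2^-1 ^+ N) by move=> _ [M _ <-].
pose h x : R := sup (E x).
have hlo N x : S N x <= h x.
  apply: ub_le_sup; last by exists N.
  by exists (S 0%N x + 2^-1 ^+ 0); exact: Eub.
have hup N x : h x <= S N x + 2^-1 ^+ N by apply: ge_sup.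
have ch : continuous h.
  apply: uniform_approx_continuous => e e0.
  have [N] : exists N, 2^-1 ^+ N < e.
    have [N _ /(_ N (leqnn _))] := near_infty_natSinv_expn_lt (PosNum e0).
    by rewrite div1r -exprVn; exists N.
  move=> Ne; exists (S N) => x; rewrite ger0_norm ?subr_ge0 //.
  by have := hup N x; lra.
exists (mkcts ch), a; split => // x.
have [n fn] := f0 x; apply: lt_le_trans (hlo n.+1 x).
by rewrite SS; have := vp n x fn; have := Sup 0%N n x; rewrite S0 add0n; lra.
Qed.

(** If the functions killed by [chi] had no common zero, the sets where they do
    not vanish would cover the space, and countably many of them [f_k] would be
    enough.  The positive function [h] built from the [f_k] is invertible, so
    [chi h] is nonzero; but [0 <= h <= S_N + 2^-N] where [chi S_N = 0], so
    [0 <= chi h <= 2^-N] for all [N].  At a common zero [x], the function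
    [f - chi f] shows that [chi f = f x]. *)
Lemma lindelof_character (X : topologicalType)
    (chi : {rmorphism continuousType X R -> R}) :
  lindelof_space X -> exists x, forall f, chi f = f x.
Proof.
move=> lX.
suff [x xP] : exists x, forall f, chi f = 0 -> f x = 0.
  exists x => f; apply/eqP; rewrite -subr_eq0 -oppr_eq0 opprB.
  apply/eqP; apply: (xP (f - cts_const (chi f))).
  by rewrite rmorphB character_const subrr.
apply: contrapT => noX.
have [|f|x|e ecov] := @lindelof_sequence X {f | chi f = 0}
    (fun f => [set x | sval f x != 0]) lX.
- by exists; exists 0; exact: rmorph0.
- apply: (@open_comp _ _ (sval f) [set r | r != 0]); last exact: open_neq.
  by move=> x _; exact: cts_fun.
- apply: contrapT => nf; apply: noX; exists x => f cf; apply: contrapT => /eqP fx.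
  by apply: nf; exists (exist _ f cf).
have [h [a [h0 hS]]] := positive_series ecov.
have : chi h != 0 by apply: character_unit => x; rewrite gt_eqF.
rewrite eq_le negb_and => /orP[|]; last first.
  have := @character_mono R X chi 0 h; rewrite rmorph0 => -> // x.
  exact: ltW.
move=> /negP; apply; apply/ler_addgt0Pr => d d0; rewrite add0r.
have [N _ /(_ N (leqnn _))] := near_infty_natSinv_expn_lt (PosNum d0).
rewrite div1r -exprVn => /= /ltW Ne.
pose S : continuousType X R := \sum_(k < N) a k * sval (e k).
apply: (@le_trans _ _ (chi (S + cts_const (2^-1 ^+ N)))).
  by apply: character_mono => x; exact: hS.
rewrite rmorphD character_const rmorph_sum big1 ?add0r // => k _.
by rewrite rmorphM (svalP (e k)) mulr0.
Qed.

End LindelofCharacter.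

(** * From ring homomorphisms to continuous maps *)

Section Duality.
Context {R : realType}.

(** Composing [Phi] with the evaluation at [x] gives a character of the
    Lindelof space [Y], hence a point [t x] of [Y]. *)
Lemma lindelof_dual (X Y : topologicalType)
    (Phi : {rmorphism continuousType Y R -> continuousType X R}) :
  tychonoff_space Y -> lindelof_space Y ->
  exists t : continuousType X Y, forall g x, Phi g x = g (t x).
Proof.
move=> tY lY.
have /choice[t tP] x : exists y, forall g, Phi g x = g y.
  exact: (lindelof_character (cts_eval x \o Phi) lY).
have ct : continuous t.
  apply: (continuous_tychonoff (R := R) tY) => g.
  rewrite (_ : g \o t = Phi g); first exact: cts_fun.
  by apply/funext => x /=; rewrite tP.
by exists (mkcts ct) => g x; exact: tP.
Qed.

(** By duality, the inverse of the isomorphism is composition with a map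
    [i : X -> Y], and for [f : X -> Z] with [Z] Lindelof the composite of
    [g |-> g \o f] with the isomorphism is composition with a map [Y -> Z].
    That this map is the unique factorisation of [f] through [i] can be tested
    on functions [g : Z -> R]. *)
Lemma isomorphic_lindelofifiable (X Y : topologicalType)
    (phi : {rmorphism continuousType X R -> continuousType Y R}) :
  tychonoff_space Y -> lindelof_space Y -> bijective phi ->
  functorially_lindelofifiable X.
Proof.
move=> tY lY [psi phiK psiK].
pose psiR : {rmorphism continuousType Y R -> continuousType X R} :=
  HB.pack_for {rmorphism continuousType Y R -> continuousType X R} psi
    (GRing.isZmodMorphism.Build _ _ psi (can2_zmod_morphism phiK psiK))
    (GRing.isMonoidMorphism.Build _ _ psi (can2_monoid_morphism phiK psiK)).
have [i iP] := lindelof_dual psiR tY lY.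
exists Y, i; split => //; first exact: cts_fun.
move=> Z f tZ lZ cf; pose fc : continuousType X Z := mkcts cf.
have [t tP] := lindelof_dual (phi \o cts_pull fc) tZ lZ.
exists t; split.
  split; first exact: cts_fun.
  apply/funext => x; apply: (tychonoff_separates_points (R := R) tZ) => g /=.
  have tg : phi (cts_pull fc g) = cts_pull t g.
    by apply/continuousEP => y; exact: tP.
  by rewrite -[RHS]/(cts_pull t g (i x)) -iP -tg /= phiK.
move=> s [cs fs]; pose sc : continuousType Y Z := mkcts cs.
apply/funext => y; apply: (tychonoff_separates_points (R := R) tZ) => g.
rewrite -tP -[RHS]/(cts_pull sc g y) -[cts_pull sc g]psiK /=.
congr (phi _ y); apply/continuousEP => x.
rewrite -[psi]/(psiR : _ -> _) iP; congr (g _).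
exact: (congr1 (fun k : X -> Z => k x) fs).
Qed.

End Duality.

(** * Extension of functions to the realcompactification *)

Section Trace.
Context {X T : topologicalType} (s : X -> T).

(** Limits along this filter on [X] are limits at [b] of functions that are
    defined on the image of [X] only; this turns the algebra of extensions to
    [b] into the algebra of limits. *)
Definition trace (b : T) : set_system X :=
  filter_from (nbhs b) (fun V => s @^-1` V).

Lemma trace_filter b : Filter (trace b).
Proof.
apply: filter_from_filter; first by exists setT; exact: filterT.
by move=> V W nV nW; exists (V `&` W); [exact: filterI | ].
Qed.

Lemma trace_proper b : closure (range s) b -> ProperFilter (trace b).
Proof.
move=> clb; apply: Build_ProperFilter_ex; last exact: trace_filter.
move=> A [V nV VA]; have [_ [[x _ <-] Vx]] := clb V nV.
by exists x; exact: VA.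
Qed.

Lemma cvg_trace b : s @ trace b --> b.
Proof. by move=> V nV; exists V. Qed.

Lemma cvg_trace_within (U : topologicalType) (g : T -> U) b :
  {within range s `|` [set b], continuous g} -> (g \o s) @ trace b --> g b.
Proof.
move=> /subspace_continuousP cg W nW.
have := cg b (or_intror erefl) W nW; rewrite /within /= => nV.
by exists [set c | (range s `|` [set b]) c -> W (g c)] => // x /=; apply; left; exists x.
Qed.

End Trace.

(** As [s] is an embedding, [f] can be transported to the image of [s], and
    continuity within the image leaves the values elsewhere arbitrary. *)
Lemma initial_extend (R : realType) (X T : topologicalType) (s : X -> T)
    (f : X -> R) :
  injective s ->
  (forall U, open U -> exists2 V, open V & s @^-1` V = U) -> continuous f ->
  exists g : T -> R, {within range s, continuous g} /\ forall x, g (s x) = f x.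
Proof.
move=> sI sopen cf.
pose g b := if pselect (exists x, s x = b) is left ex then f (projT1 (cid ex)) else 0.
have gs x : g (s x) = f x.
  rewrite /g; case: pselect => [ex|[]]; last by exists x.
  by congr f; apply: sI; exact: (projT2 (cid ex)).
exists g; split => //; apply/subspace_continuousP => _ [x _ <-] W nW.
have {nW} : nbhs (f x) W by rewrite -gs.
rewrite (@nbhsE R (f x)) => -[Q [oQ Qfx] QW].
have [V oV VQ] := sopen (f @^-1` Q) (open_comp (fun x _ => cf x) oQ).
have nV : nbhs (s x) V.
  by apply: open_nbhs_nbhs; split => //; rewrite -[V _]/((s @^-1` V) x) VQ.
apply: filterS nV => c Vc [y _ yc]; have : W (g c); last by [].
  rewrite -yc gs; apply: QW.
  by rewrite -[Q _]/((f @^-1` Q) y) -VQ /= yc.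
Qed.

Section Realcompactification.
Context {R : realType} {X : topologicalType}.
Local Notation bX := (stone_cech R X).
Local Notation uX := (set_type (realcompactification R X)).
Local Notation s := (@stone_cech_in R X).

Local Instance stone_cech_trace_proper (b : bX) : ProperFilter (trace s b).
Proof. by apply: trace_proper; rewrite stone_cech_in_dense. Qed.

Lemma realcompactification_cvg (b : uX) (f : X -> R) : continuous f ->
  f @ trace s (val b) --> lim (f @ trace s (val b)).
Proof.
move=> cf; have [g [cg gs]] := set_mem (valP b) f cf.
apply: (cvgP (g (val b))); rewrite (_ : f = g \o s); first exact: cvg_trace_within.
by apply/funext => x /=; rewrite gs.
Qed.

(** The value at [b] is within [e] of the values of [f] on the trace of a
    neighbourhood of [b], hence, closed balls being closed, within [e] of the
    limits of [f] at all points of that neighbourhood. *)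
Fact rc_extend_continuous (f : continuousType X R) :
  continuous (fun b : uX => lim (f @ trace s (val b))).
Proof.
move=> b; apply/(@cvgrPdist_le R R uX (nbhs b) (nbhs_filter b)) => e e0.
have cf : continuous f by exact: cts_fun.
have /cvgrPdist_le/(_ e e0)[V] := realcompactification_cvg (b := b) cf.
rewrite (@nbhsE bX) => -[Q [oQ Qb] QV] Vf.
have nQ : nbhs b (val @^-1` Q : set uX).
  apply: (@initial_continuous _ _ (val : uX -> bX)).
  exact: open_nbhs_nbhs.
apply: (@filterS _ _ (nbhs_filter b) _ _ _ nQ) => c Qc.
set l := lim _ in Vf *.
apply: (@closed_cvg _ _ _ (stone_cech_trace_proper (val c)) f
  [set r | `|l - r| <= e] _ _ _ (realcompactification_cvg cf)); last first.
  by exists Q; [exact: open_nbhs_nbhs | move=> x /QV; exact: Vf].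
apply: (@closed_comp _ _ (fun r : R => `|l - r|) [set r | r <= e]); last exact: closed_le.
move=> r _; apply: (@continuous_comp _ _ _ (fun r : R => l - r) Num.norm).
  by apply: cvgB; [exact: cvg_cst | exact: cvg_id].
exact: norm_continuous.
Qed.

Definition rc_extend (f : continuousType X R) : continuousType uX R :=
  mkcts (@rc_extend_continuous f).

Lemma rc_extend_unique (f : continuousType X R) (b : uX) l :
  f @ trace s (val b) --> l -> rc_extend f b = l.
Proof. by move=> fl; apply: cvg_lim => //; exact: Rhausdorff. Qed.

Lemma rc_extend_cvg (f : continuousType X R) (b : uX) :
  f @ trace s (val b) --> rc_extend f b.
Proof. by apply: realcompactification_cvg; exact: cts_fun. Qed.

Fact rc_extend_zmod : zmod_morphism rc_extend.
Proof.
move=> f g; apply/continuousEP => b; apply: rc_extend_unique.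
exact: (cvgB (@rc_extend_cvg f b) (@rc_extend_cvg g b)).
Qed.
Fact rc_extend_monoid : monoid_morphism rc_extend.
Proof.
split=> [|f g]; apply/continuousEP => b; apply: rc_extend_unique.
  exact: cvg_cst.
exact: (cvgM (@rc_extend_cvg f b) (@rc_extend_cvg g b)).
Qed.
HB.instance Definition _ := GRing.isZmodMorphism.Build
  (continuousType X R) (continuousType uX R) rc_extend rc_extend_zmod.
HB.instance Definition _ := GRing.isMonoidMorphism.Build
  (continuousType X R) (continuousType uX R) rc_extend rc_extend_monoid.

Lemma rc_extend_restrict (H : continuousType bX R) (b : uX) :
  rc_extend (H \o mkcts (@stone_cech_in_continuous R X)) b = H (val b).
Proof.
apply: rc_extend_unique; apply: continuous_cvg; last exact: cvg_trace.
exact: cts_fun.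
Qed.

Hypothesis tX : tychonoff_space X.

Lemma stone_cech_in_realcompactification x : realcompactification R X (s x).
Proof.
move=> f cf.
have [g [cg gs]] :=
  initial_extend (stone_cech_in_inj (R := R) tX) (stone_cech_in_initial tX) cf.
exists g; split => //; apply: continuous_subspaceW cg => _ [//|->].
by exists x.
Qed.

Definition rc_in (x : X) : uX :=
  SigSub (mem_set (stone_cech_in_realcompactification x)).

Lemma rc_in_continuous : continuous rc_in.
Proof. by apply: continuous_comp_initial; exact: stone_cech_in_continuous. Qed.

(** Extension is inverse to restriction along [X -> uX]: a continuous function
    on the realcompactification is the limit of its own restriction. *)
Lemma rc_extend_bij : bijective rc_extend.
Proof.
pose ri : continuousType X uX := mkcts rc_in_continuous.
exists (cts_pull ri) => [f|F]; apply/continuousEP.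
  move=> x; apply: rc_extend_unique => /= W; rewrite nbhsE => -[Q [oQ Qfx] QW].
  have oU : open (f @^-1` Q) by apply: open_comp => // y _; exact: cts_fun.
  have [V oV VQ] := stone_cech_in_initial (R := R) tX oU.
  exists V; first by apply: open_nbhs_nbhs; split => //; rewrite -[V _]/((s @^-1` V) x) VQ.
  by rewrite VQ => y /QW.
move=> b; apply: rc_extend_unique.
have cb : rc_in @ trace s (val b) --> b.
  move=> W [_ [[V oV <-] Vb] VW]; exists V; first exact: open_nbhs_nbhs.
  by move=> x Vx; apply: VW.
by apply: continuous_cvg cb; exact: cts_fun.
Qed.

End Realcompactification.

(** * The Lindelofification inside the Stone-Cech compactification *)

Section LindelofificationEmbeds.
Context {R : realType} {X N : topologicalType} (i : X -> N).
Hypothesis tN : tychonoff_space N.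
Hypothesis epi : forall g h : N -> R,
  continuous g -> continuous h -> g \o i = h \o i -> g = h.
Context (j : N -> stone_cech R X).
Hypothesis cj : continuous j.
Hypothesis ji : @stone_cech_in R X = j \o i.
Hypothesis ci : continuous i.

(** The restriction of [h] to [X] takes values in [[0,1]], so it extends to a
    function [H] on the compactification; [H \o j] and [h] agree on [X], hence
    everywhere.  As [N] is completely regular, its topology is the one induced
    by such [h], which makes [j] an embedding. *)
Lemma unit_function_factors (h : continuousType N R) :
  (forall y, 0 <= h y <= 1) ->
  exists2 H : stone_cech R X -> R, continuous H & (h : N -> R) = H \o j.
Proof.
move=> h01; have m x : h (i x) \in (`[0, 1]%classic : set R).
  by apply/mem_set; rewrite /= in_itv; exact: h01.
pose k : X -> unit_itv R := fun x => SigSub (m x).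
have ck : continuous k.
  apply: continuous_comp_initial => x; apply: (@continuous_comp _ _ _ i h).
    exact: ci.
  exact: cts_fun.
have [H [[cH kH] _]] := stone_cech_extend (R := R)
  (@unit_itv_hausdorff R) (@unit_itv_compact R) ck.
have cvH : continuous (val \o H : stone_cech R X -> R).
  move=> b; apply: continuous_comp; first exact: cH.
  exact: initial_continuous.
exists (val \o H) => //; apply: epi.
- exact: cts_fun.
- by move=> y; apply: (@continuous_comp _ _ _ j (val \o H)); [exact: cj | exact: cvH].
- apply/funext => x; rewrite -[RHS]/(val ((H \o (j \o i)) x)) -ji.
  by rewrite -kH.
Qed.

Lemma lindelofification_initial_at (y : N) (W : set N) : nbhs y W ->
  exists V, [/\ open V, V (j y) & j @^-1` V `<=` W].
Proof.
move=> nW; have [h [hy h01 hW]] := tychonoff_separates_closed (R := R) tN nW.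
have [H cH hH] := unit_function_factors h01.
have hE z : h z = H (j z) by rewrite hH.
exists (H @^-1` [set r | r < 1]); split.
- by apply: open_comp => [b _|]; [exact: cH | exact: open_lt].
- by rewrite /= -hE hy ltr01.
- by move=> z /=; rewrite -hE => hz; apply: contrapT => /hW hz1; rewrite hz1 ltxx in hz.
Qed.

Lemma lindelofification_inj : injective j.
Proof.
move=> y z jyz; apply: tN.1 => A B nA nB.
have [V [_ Vy VA]] := lindelofification_initial_at nA.
by exists z; split; [apply: VA; rewrite /= -jyz | exact: nbhs_singleton].
Qed.

Lemma lindelofification_initial (U : set N) : open U ->
  exists2 V, open V & j @^-1` V = U.
Proof.
move=> oU; exists (\bigcup_(V in [set V | open V /\ j @^-1` V `<=` U]) V).
  by apply: bigcup_open => V [].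
apply/seteqP; split => [y [V [_ VU] Vy]|y Uy]; first exact: VU.
have [V [oV Vy VU]] := lindelofification_initial_at (open_nbhs_nbhs (conj oU Uy)).
by exists V.
Qed.

End LindelofificationEmbeds.

(** The realcompactification is the image of the embedding [j] of the
    Lindelofification [N] in the Stone-Cech compactification.  A function on [X]
    extends to [N], the real line being Lindelof, so points of the image lie in
    the realcompactification.  Conversely a point [b] of the realcompactification
    defines a character of [N], by restricting functions to [X] and extending
    them to [b]; this character is the evaluation at some [y], and [j y = b]
    since functions on the compactification take the same value at both. *)
Lemma lindelofifiable_realcompactification (R : realType) (X : topologicalType) :
  functorially_lindelofifiable X ->
  lindelof_space (set_type (realcompactification R X)).
Proof.
move=> [N [i [tN lN ci univ]]]; pose ic : continuousType X N := mkcts ci.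
have univR f := univ R f tychonoff_real (@lindelof_real R).
have epi (g h : N -> R) : continuous g -> continuous h -> g \o i = h \o i -> g = h.
  move=> cg ch gh.
  have [|k [_ kP]] := univR (g \o i).
    by move=> x; apply: continuous_comp; [exact: ci | exact: cg].
  by rewrite -(kP g (conj cg erefl)) -(kP h (conj ch gh)).
have tB : tychonoff_space (stone_cech R X).
  by apply: (tychonoff_compact (R := R)); [exact: stone_cech_hausdorff
                                         | exact: stone_cech_compact].
have [j [[cj ji] _]] := univ _ (@stone_cech_in R X) tB
  (compact_lindelof (@stone_cech_compact R X)) (@stone_cech_in_continuous R X).
pose jc : continuousType N (stone_cech R X) := mkcts cj.
have jrc y : realcompactification R X (j y).
  move=> f cf; have [ft [[cft fE] _]] := univR f cf.
  have [g [cg gj]] := initial_extend (lindelofification_inj tN epi cj ji ci)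
    (lindelofification_initial tN epi cj ji ci) cft.
  exists g; split.
    apply: continuous_subspaceW cg => _ [[x _ <-]|->]; last by exists y.
    by rewrite ji; exists (i x).
  by move=> x; rewrite ji /= gj fE.
pose t y : set_type (realcompactification R X) := SigSub (mem_set (jrc y)).
have ct : continuous t by apply: continuous_comp_initial.
apply: (lindelof_image ct _ lN); apply/seteqP; split => // b _.
have [y yP] := lindelof_character (cts_eval b \o rc_extend \o cts_pull ic) lN.
exists y => //; apply: val_inj; apply: (tychonoff_separates_points (R := R) tB) => H.
rewrite -(rc_extend_restrict H b) -[LHS]/(cts_pull jc H y) -yP /=.
congr (rc_extend _ b); apply/continuousEP => x.
exact: (congr1 (fun k : X -> stone_cech R X => H (k x)) (esym ji)).
Qed.

Lemma lindelof_realcompactification_isomorphic (R : realType)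
    (X : topologicalType) (tX : tychonoff_space X) :
  lindelof_space (set_type (realcompactification R X)) ->
  exists Y : topologicalType, [/\ tychonoff_space Y, lindelof_space Y &
    exists phi : {rmorphism continuousType X R -> continuousType Y R},
      bijective phi].
Proof.
move=> lU; exists (set_type (realcompactification R X)); split => //.
  apply: (tychonoff_set_type (R := R)); apply: (tychonoff_compact (R := R)).
    exact: stone_cech_hausdorff.
  exact: stone_cech_compact.
by exists rc_extend; exact: rc_extend_bij.
Qed.

Theorem corollary3p10 (R : realType) (X : topologicalType)
    (hX : tychonoff_space X) :
  [<-> functorially_lindelofifiable X;
       lindelof_space (set_type (realcompactification R X));
       exists Y : topologicalType,
         [/\ tychonoff_space Y, lindelof_space Y &
           exists phi : {rmorphism continuousType X R -> continuousType Y R},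
             bijective phi] ].
Proof.
tfae.
- exact: lindelofifiable_realcompactification.
- exact: lindelof_realcompactification_isomorphic.
- by move=> [Y [tY lY [phi bphi]]]; exact: (isomorphic_lindelofifiable tY lY bphi).
Qed.
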